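(* In the social learning model, assume there exist $c>0$, $k>0$ and $x_0>0$ such that $G_-(-x)=c\,x^{-k}$ and $G_+(x)=1-c\,x^{-k}$ for all $x>x_0$. Then $\mathbb{E}(T_L)<\infty$.
   Context: Social learning model. A state $\theta\in\{-1,+1\}$ is drawn with $\mathbb{P}(\theta=+1)=\mathbb{P}(\theta=-1)=1/2$. Agents $t=1,2,\dots$ receive private signals $s_t\in\mathbb{R}$ that are i.i.d. conditionally on $\theta$, with CDF $F_+$ if $\theta=+1$ and $F_-$ if $\theta=-1$; $F_+$ and $F_-$ are mutually absolutely continuous. Let $L_t=\log\frac{\mathbb{P}(\theta=+1\mid s_t)}{\mathbb{P}(\theta=-1\mid s_t)}$ be the private log-likelihood ratio, and let $G_+$, $G_-$ denote the CDFs of $L_t$ conditional on $\theta=+1$, $\theta=-1$ respectively. Signals are assumed unbounded: for every $M\in\mathbb{R}$, $\mathbb{P}(L_t>M)>0$ and $\mathbb{P}(L_t<-M)>0$. Agent $t$ observes $a_1,\dots,a_{t-1}$ and her own signal and chooses $a_t\in\{-1,+1\}$ (utility $1$ if $a_t=\theta$, else $0$). The public belief is $\mu_t=\mathbb{P}(\theta=+1\mid a_1,\dots,a_{t-1})$ and $\ell_t=\log\frac{\mu_t}{1-\mu_t}$ (so $\ell_1=0$). In equilibrium $a_t=+1$ iff $\ell_t+L_t>0$, and otherwise $a_t=-1$. Consequently $\ell_{t+1}=\ell_t+D_+(\ell_t)$ if $a_t=+1$ and $\ell_{t+1}=\ell_t+D_-(\ell_t)$ if $a_t=-1$, where $D_+(x)=\log\frac{1-G_+(-x)}{1-G_-(-x)}$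 and $D_-(x)=\log\frac{G_+(-x)}{G_-(-x)}$. We write $\mathbb{P}_+(\cdot)=\mathbb{P}(\cdot\mid\theta=+1)$ and $\mathbb{E}_+$ for the corresponding expectation. The time to learn is $T_L=\min\{t: a_\tau=\theta\text{ for all }\tau\ge t\}$. *)

(* Defs.v *)
From HB Require Import structures.
From mathcomp Require Import all_boot all_order all_algebra.
From mathcomp Require Import all_classical all_reals all_analysis.
Set Implicit Arguments. Unset Strict Implicit. Unset Printing Implicit Defensive.
Import Order.TTheory GRing.Theory Num.Theory.
Local Open Scope classical_set_scope.
Local Open Scope ring_scope.

(* Social learning model.  Agents are indexed from 0 in Rocq:
   Rocq agent t corresponds to agent t+1 of the paper.
   States: [true] stands for theta = +1, [false] for theta = -1;
   actions likewise ([true] = +1). *)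
Section SocialLearning.
Variable R : realType.
(* f : a (strictly positive) version of the Radon-Nikodym density dF_+/dF_- *)
Variables (Fp Fm : probability R R) (f : R -> R).

(* private log-likelihood ratio of a signal u (prior is 1/2 so the
   posterior odds equal the likelihood ratio f u) *)
Definition LLR (u : R) : R := ln (f u).

Definition Gp (x : R) : R := fine (Fp [set u | LLR u <= x]).
Definition Gm (x : R) : R := fine (Fm [set u | LLR u <= x]).

Definition Dp (x : R) : R := ln ((1 - Gp (- x)) / (1 - Gm (- x))).
Definition Dm (x : R) : R := ln (Gp (- x) / Gm (- x)).

Variables (T : Type) (s : nat -> T -> R).

(* public log-likelihood ratio ell_t (ell 0 = paper's ell_1 = 0) *)
Fixpoint pub_llr (t : nat) (w : T) : R :=
  match t with
  | 0%N => 0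
  | t'.+1 => let l := pub_llr t' w in
             if 0 < l + LLR (s t' w) then l + Dp l else l + Dm l
  end.

Definition action (t : nat) (w : T) : bool := 0 < pub_llr t w + LLR (s t w).

(* time to learn T_L = min { t : a_tau = theta for all tau >= t }
   (paper's 1-based indexing, hence the t.+1), +oo if no such t *)
Definition time_to_learn (theta : T -> bool) (w : T) : \bar R :=
  ereal_inf [set ((t.+1)%:R)%:E | t in
     [set t : nat | forall tau, (t <= tau)%N -> action tau w = theta w]].
End SocialLearning.

(* Main.v *)
Require Import Defs.
From HB Require Import structures.
From mathcomp Require Import all_boot all_order all_algebra.
From mathcomp Require Import all_classical all_reals all_analysis.
From mathcomp Require Import measurable_realfun ring lra.
Import Order.TTheory GRing.Theory Num.Theory.
Local Open Scope classical_set_scope.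
Local Open Scope ring_scope.

(** For a finite history [h] of actions let [p_+ h] and [p_- h] be its
    probabilities in the two states; the public log-likelihood ratio is
    [ln (p_+ h / p_- h)].  A history ending with a wrong action is at least as
    likely in the other state.  Summing over the time of the first wrong action
    after [h], a mistake after [h] has probability at most
    [min (p_+ h) (p_- h)], so the expected time to learn is at most
    [1 + sum_t sum_(|h| = t) min (p_+ h) (p_- h)].

    The Bhattacharyya sums [Z_t = sum_(|h| = t) sqrt (p_+ h * p_- h)] turn this
    into a telescoping series: one more action multiplies the term of [h] by the
    affinity [rho] of the two action laws at the public log-likelihood ratio [x]
    of [h], while [min (p_+ h) (p_- h) = sqrt (p_+ h * p_- h) * exp (- |x| / 2)].
    Polynomial tails make [1 - rho] at least of polynomial order in [1 / |x|],
    hence [exp (- |x| / 2) <= K * (1 - rho)] for some [K], and the double sum is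
    at most [K * Z_0 = K]. *)

(** * Affinity of two Bernoulli laws; powers against exponentials *)

Definition bhattacharyya {R : realType} (p q : R) : R :=
  Num.sqrt (p * q) + Num.sqrt ((1 - p) * (1 - q)).

(** The right-hand side is half of [(sqrt p - sqrt q)^2 + (sqrt (1-p) - sqrt (1-q))^2], of which
    only the first square is kept. Multiplying it by [(sqrt p + sqrt q)^2 <= 4] gives [(q - p)^2],
    hence the 8. *)
Lemma bhattacharyya_gap (R : realType) (p q : R) : 0 <= p <= 1 -> 0 <= q <= 1 ->
  (q - p) ^+ 2 / 8 <= 1 - bhattacharyya p q.
Proof.
move=> /andP[p0 p1] /andP[q0 q1]; rewrite /bhattacharyya.
rewrite !sqrtrM ?subr_ge0//.
have := sqr_sqrtr p0; have := sqr_sqrtr q0.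
have q1' : 0 <= 1 - q by rewrite subr_ge0.
have p1' : 0 <= 1 - p by rewrite subr_ge0.
have := sqr_sqrtr p1'; have := sqr_sqrtr q1'.
have := sqrtr_ge0 p; have := sqrtr_ge0 q.
move: (Num.sqrt p) (Num.sqrt q) (Num.sqrt (1 - p)) (Num.sqrt (1 - q)).
move=> a b u v b0 a0 v2 u2 b2 a2.
have huv : u * v <= (u ^+ 2 + v ^+ 2) / 2.
  have := sqr_ge0 (u - v); rewrite sqrrB; lra.
have hab : (a - b) ^+ 2 / 2 <= 1 - (a * b + u * v).
  rewrite sqrrB; lra.
apply: le_trans hab.
have -> : (q - p) ^+ 2 = (a - b) ^+ 2 * (a + b) ^+ 2 by rewrite -a2 -b2; ring.
have : (a + b) ^+ 2 <= 4.
  have := sqr_ge0 (a - b); rewrite sqrrB sqrrD; lra.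
move/(ler_wpM2l (sqr_ge0 (a - b))); lra.
Qed.

(** This is [ln y <= y - 1] at [y = z / (2 * a)]. The constant is the maximum of
    [z^a * exp (- z / 2)], attained at [z = 2 * a]. *)
Lemma powR_le_expR (R : realType) (a : R) : 0 < a ->
  exists2 C : R, 0 < C & forall z, 0 < z -> powR z a <= C * expR (z / 2).
Proof.
move=> a0; exists (expR (a * ln (2 * a) - a)); first exact: expR_gt0.
move=> z z0; rewrite -expRD /powR gt_eqF// ler_expR.
have y0 : 0 < z / (2 * a) by rewrite divr_gt0// mulr_gt0.
have h : ln (z / (2 * a)) <= z / (2 * a) - 1.
  have : -1 < z / (2 * a) - 1 by lra.
  by move/le_ln1Dx; rewrite addrC subrK.
rewrite ln_div ?posrE ?mulr_gt0// in h.
have e : a * (z / (2 * a)) = z / 2 by field; rewrite gt_eqF.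
have := ler_wpM2l (ltW a0) h; rewrite !mulrBr e; lra.
Qed.

(** * Signal laws, density bounds and action probabilities *)

Section Signals.
Set Implicit Arguments.
Unset Strict Implicit.
Context {R : realType} (Fp Fm : probability R R) (f : R -> R).
Hypotheses (mf : measurable_fun setT f) (f_gt0 : forall u, 0 < f u)
  (density : forall B, measurable B -> Fp B = (\int[Fm]_(u in B) (f u)%:E)%E).

Lemma measurable_LLR : measurable_fun setT (LLR f).
Proof. exact: measurableT_comp (@measurable_ln R) mf. Qed.

Lemma LLR_exp (u : R) : expR (LLR f u) = f u.
Proof. by rewrite /LLR lnK// posrE. Qed.

Lemma density_le (a : R) (A : set R) : measurable A ->
  A `<=` [set u | LLR f u <= a] -> fine (Fp A) <= expR a * fine (Fm A).
Proof.
move=> mA Aa; rewrite -[expR a]/(fine (expR a)%:E) -fineM ?fin_num_measure//.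
apply: fine_le; rewrite ?fin_numM ?fin_num_measure//.
rewrite density// -integral_cst//; apply: ge0_le_integral => //.
- by move=> u _; rewrite lee_fin ltW.
- by apply/measurable_EFinP; exact: measurable_funTS.
- by move=> u /Aa /=; rewrite lee_fin -LLR_exp ler_expR.
Qed.

Lemma density_ge (a : R) (A : set R) : measurable A ->
  A `<=` [set u | a <= LLR f u] -> expR a * fine (Fm A) <= fine (Fp A).
Proof.
move=> mA Aa; rewrite -[expR a]/(fine (expR a)%:E) -fineM ?fin_num_measure//.
apply: fine_le; rewrite ?fin_numM ?fin_num_measure//.
rewrite density// -integral_cst//; apply: ge0_le_integral => //.
- by move=> u _; rewrite lee_fin expR_ge0.
- by apply/measurable_EFinP; exact: measurable_funTS.
- by move=> u /Aa /=; rewrite lee_fin -LLR_exp ler_expR.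
Qed.

Definition signal_law (b : bool) : probability R R := if b then Fp else Fm.

Definition action_region (l : R) (a : bool) : set R :=
  [set u | (0 < l + LLR f u) = a].

Definition action_prob (b : bool) (l : R) (a : bool) : R :=
  fine (signal_law b (action_region l a)).

Lemma action_regionF (l : R) : action_region l false = [set u | LLR f u <= - l].
Proof.
apply/seteqP; split=> u; rewrite /action_region/=.
  by move=> /negbT; rewrite -leNgt -lerBrDl sub0r.
by move=> h; apply/negbTE; rewrite -leNgt -lerBrDl sub0r.
Qed.

Lemma action_regionT (l : R) : action_region l true = [set u | - l < LLR f u].
Proof. by apply/seteqP; split=> u; rewrite /action_region/= -ltrBlDl sub0r. Qed.

Lemma measurable_LLR_le (x : R) : measurable [set u | LLR f u <= x].
Proof.
rewrite -[X in measurable X]setTI; apply: measurable_fun_le => //.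
exact: measurable_LLR.
Qed.

Lemma LLR_gt_setC (x : R) :
  [set u | x < LLR f u] = ~` [set u | LLR f u <= x].
Proof.
by apply/seteqP; split=> u /=; [rewrite ltNge => /negP|move=> /negP; rewrite -ltNge].
Qed.

Lemma measurable_LLR_gt (x : R) : measurable [set u | x < LLR f u].
Proof. by rewrite LLR_gt_setC; apply: measurableC; exact: measurable_LLR_le. Qed.

Lemma measurable_action_region (l : R) (a : bool) :
  measurable (action_region l a).
Proof.
by case: a; rewrite ?action_regionT ?action_regionF;
  [exact: measurable_LLR_gt|exact: measurable_LLR_le].
Qed.

Lemma fine_prob_LLR_gt (F : probability R R) (x : R) :
  fine (F [set u | x < LLR f u]) = 1 - fine (F [set u | LLR f u <= x]).
Proof.
rewrite LLR_gt_setC probability_setC; last exact: measurable_LLR_le.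
by rewrite fineB// fin_num_measure//; exact: measurable_LLR_le.
Qed.

Lemma action_probT (b : bool) (l : R) :
  action_prob b l true = 1 - action_prob b l false.
Proof. by rewrite /action_prob action_regionT action_regionF fine_prob_LLR_gt. Qed.

Lemma action_prob_ge0 (b : bool) (l : R) (a : bool) : 0 <= action_prob b l a.
Proof. exact: fine_ge0. Qed.

Lemma action_prob_le1 (b : bool) (l : R) (a : bool) : action_prob b l a <= 1.
Proof.
have := action_probT b l; have := action_prob_ge0 b l true.
by have := action_prob_ge0 b l false; case: a; lra.
Qed.

(** The region of [~~ b] is where [l + LLR] does not favour [b]; there the density is bounded by
    [expR (- l)], from above or below according to [b]. *)
Lemma action_prob_wrong (b : bool) (l : R) :
  action_prob b l (~~ b) <=
  expR (if b then - l else l) * action_prob (~~ b) l (~~ b).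
Proof.
case: b => /=; rewrite /action_prob/=.
  by apply: density_le; [exact: measurable_action_region|rewrite action_regionF].
have := @density_ge (- l) (action_region l true).
have h : action_region l true `<=` [set u | - l <= LLR f u].
  by rewrite action_regionT => u /= /ltW.
move=> /(_ (measurable_action_region _ _) h) /(ler_wpM2l (expR_ge0 l)).
by rewrite mulrA -expRD subrr expR0 mul1r.
Qed.

Lemma fine_prob_setD (F : probability R R) (A B : set R) :
  measurable A -> measurable B -> B `<=` A ->
  fine (F A) = fine (F B) + fine (F (A `\` B)).
Proof.
move=> mA mB BA; rewrite -fineD ?fin_num_measure//; last exact: measurableD.
by rewrite (measureDI F mA mB) (setIidr BA) addeC.
Qed.

(** * Separation of the action laws in the two states *)

(** Split the tail at [- z]. Below [- z] the density is at most [expR (- z)], so [Fm] has the stated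
    surplus; between [- z] and [- y] it is at most 1, so that part does not reduce the surplus. *)
Lemma Gm_Gp_gap_left (y z : R) : 0 <= y <= z ->
  (1 - expR (- z)) * Gm Fm f (- z) <= Gm Fm f (- y) - Gp Fp f (- y).
Proof.
move=> /andP[y0 yz]; rewrite /Gm /Gp.
have m x := measurable_LLR_le x.
have sub : [set u | LLR f u <= - z] `<=` [set u | LLR f u <= - y].
  by move=> u /= /le_trans; apply; rewrite lerN2.
rewrite (fine_prob_setD Fm (m (- y)) (m (- z)) sub).
rewrite (fine_prob_setD Fp (m (- y)) (m (- z)) sub).
have := @density_le (- z) _ (m (- z)) (fun _ => id).
have sub0 : [set u | LLR f u <= - y] `\` [set u | LLR f u <= - z] `<=`
            [set u | LLR f u <= 0].
  by move=> u /= [/le_trans h _]; apply: h; rewrite oppr_le0.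
have := density_le (measurableD (m (- y)) (m (- z))) sub0.
by rewrite expR0 mul1r mulrBl mul1r; lra.
Qed.

(** Mirror image on the upper tails, where [Fp] has the surplus. *)
Lemma Gm_Gp_gap_right (y z : R) : 0 <= y <= z ->
  (1 - expR (- z)) * (1 - Gp Fp f z) <= Gm Fm f y - Gp Fp f y.
Proof.
move=> /andP[y0 yz].
have -> : Gm Fm f y - Gp Fp f y = (1 - Gp Fp f y) - (1 - Gm Fm f y) by ring.
rewrite /Gm /Gp -!fine_prob_LLR_gt.
have m x := measurable_LLR_gt x.
have sub : [set u | z < LLR f u] `<=` [set u | y < LLR f u].
  by move=> u /=; apply: le_lt_trans.
rewrite (fine_prob_setD Fm (m y) (m z) sub) (fine_prob_setD Fp (m y) (m z) sub).
have h1 : fine (Fm ([set u | y < LLR f u] `\` [set u | z < LLR f u])) <=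
          fine (Fp ([set u | y < LLR f u] `\` [set u | z < LLR f u])).
  rewrite -[leLHS]mul1r -expR0; apply: density_ge; first exact: measurableD.
  by move=> u /= [/ltW yu _]; exact: le_trans yu.
have h2 : fine (Fm [set u | z < LLR f u]) <=
          expR (- z) * fine (Fp [set u | z < LLR f u]).
  rewrite -[leLHS]mul1r -expR0 -(addNr z) expRD -mulrA.
  apply: ler_wpM2l; first exact: expR_ge0.
  by apply: density_ge => // u /= /ltW.
by rewrite mulrBl mul1r; lra.
Qed.

Lemma bhattacharyya_polynomial_tails (c k x0 : R) : 0 < c -> 0 < k -> 0 < x0 ->
  (forall x, x0 < x -> Gm Fm f (- x) = c * powR x (- k) /\
                       Gp Fp f x = 1 - c * powR x (- k)) ->
  exists2 K : R, 0 < K & forall x, expR (- (`|x| / 2)) <=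
    K * (1 - bhattacharyya (action_prob true x false) (action_prob false x false)).
Proof.
move=> c0 k0 x00 tails.
(* The exponent doubles because [bhattacharyya_gap] squares a difference of order [z^(-k)]. *)
have [|C C0 powC] := @powR_le_expR R (k + k); first by rewrite addr_gt0.
pose eta := (1 - expR (-1)) * c.
have eta0 : 0 < eta by rewrite mulr_gt0// subr_gt0 expR_lt1 ltrN10.
exists (8 * C * expR ((x0 + 1) / 2) / eta ^+ 2).
  by rewrite divr_gt0 ?exprn_gt0// !mulr_gt0// expR_gt0.
move=> x; set p := action_prob true x false; set q := action_prob false x false.
(* This [z] exceeds [x0], so the tail formulas apply; it is at least [|x|], as the gap lemmas ask;
   and it is at least 1, so [1 - expR (- z)] is at least [1 - expR (-1)]. The shift costs only the
   factor [expR ((x0 + 1) / 2)]. *)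
pose z := x0 + 1 + `|x|.
have x_ge0 := normr_ge0 x.
have z0 : 0 < z by rewrite /z; lra.
have zx : x0 < z by rewrite /z; lra.
have [tm tp] := tails z zx.
have pE : p = Gp Fp f (- x) by rewrite /p /action_prob action_regionF.
have qE : q = Gm Fm f (- x) by rewrite /q /action_prob action_regionF.
have xz : `|x| <= z by rewrite /z; lra.
have pow0 : 0 < powR z (- k) by exact: powR_gt0.
have gap : eta * powR z (- k) <= q - p.
  apply: (@le_trans _ _ ((1 - expR (- z)) * (c * powR z (- k)))).
    rewrite /eta -mulrA; apply: ler_wpM2r; first by rewrite mulr_ge0// ltW.
    by rewrite lerD2l lerN2 ler_expR lerN2 /z; lra.
  rewrite pE qE; have [x_0|x_0] := leP 0 x.
    by rewrite -tm; apply: Gm_Gp_gap_left; rewrite x_0 -(ger0_norm x_0).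
  have -> : c * powR z (- k) = 1 - Gp Fp f z by rewrite tp; ring.
  by apply: Gm_Gp_gap_right; rewrite -(ltr0_norm x_0) xz x_ge0.
have p01 : 0 <= p <= 1 by rewrite action_prob_ge0 action_prob_le1.
have q01 : 0 <= q <= 1 by rewrite action_prob_ge0 action_prob_le1.
have gap2 : eta ^+ 2 * powR z (- (k + k)) / 8 <= 1 - bhattacharyya p q.
  apply: le_trans (bhattacharyya_gap _ _ _ p01 q01).
  rewrite ler_pM2r ?invr_gt0//.
  have -> : eta ^+ 2 * powR z (- (k + k)) = (eta * powR z (- k)) ^+ 2.
    by rewrite opprD powRD ?(gt_eqF z0) ?implybT//; ring.
  by rewrite ler_sqr ?nnegrE// ?(le_trans _ gap)// mulr_ge0// ltW.
have decay : expR (- (z / 2)) <= C * powR z (- (k + k)).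
  rewrite expRN powRN -[leLHS]mul1r ler_pdivrMr ?expR_gt0// mulrAC.
  by rewrite ler_pdivlMr ?powR_gt0// mul1r powC.
have -> : expR (- (`|x| / 2)) = expR ((x0 + 1) / 2) * expR (- (z / 2)).
  by rewrite -expRD /z; congr expR; field.
have -> : 8 * C * expR ((x0 + 1) / 2) / eta ^+ 2 * (1 - bhattacharyya p q) =
  expR ((x0 + 1) / 2) * (C * (8 * (1 - bhattacharyya p q) / eta ^+ 2)).
  by ring.
rewrite ler_pM2l ?expR_gt0//; apply: le_trans decay _.
rewrite ler_pM2l// ler_pdivlMr ?exprn_gt0// mulrC; lra.
Qed.

(** * Probabilities and likelihood ratios of finite histories *)

(* Histories list the most recent action first. *)
Fixpoint hist_llr (h : seq bool) : R :=
  if h is a :: h' then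
    let l := hist_llr h' in if a then l + Dp Fp Fm f l else l + Dm Fp Fm f l
  else 0.

(** Defined by the chain rule alone; [history_event_prob] later identifies it with the conditional
    probability of [h] given the state. *)
Fixpoint hist_prob (b : bool) (h : seq bool) : R :=
  if h is a :: h' then hist_prob b h' * action_prob b (hist_llr h') a else 1.

(** To be derived from unbounded signals and mutual absolute continuity. It keeps logarithms and
    quotients away from their default values at 0. *)
Hypothesis action_prob_gt0 : forall b l a, 0 < action_prob b l a.

Lemma hist_prob_gt0 (b : bool) (h : seq bool) : 0 < hist_prob b h.
Proof. by elim: h => //= a h IH; rewrite mulr_gt0. Qed.

Lemma hist_prob_cons (b a : bool) (h : seq bool) :
  hist_prob b (a :: h) + hist_prob b (~~ a :: h) = hist_prob b h.
Proof. by case: a; rewrite /= action_probT; ring. Qed.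

Lemma hist_llr_cons (a : bool) (h : seq bool) : expR (hist_llr (a :: h)) =
  expR (hist_llr h) *
  (action_prob true (hist_llr h) a / action_prob false (hist_llr h) a).
Proof.
have E b l : fine (signal_law b [set u | LLR f u <= - l]) = action_prob b l false.
  by rewrite /action_prob action_regionF.
case: a => /=; rewrite expRD; congr (_ * _).
  rewrite /Dp /Gp /Gm (E true) (E false) -!action_probT lnK// posrE.
  by rewrite divr_gt0.
by rewrite /Dm /Gp /Gm (E true) (E false) lnK// posrE divr_gt0.
Qed.

(** Each update by [Dp] or [Dm] is the log ratio of the probabilities of the observed action, and
    the prior odds are 1. *)
Lemma hist_prob_llr (h : seq bool) :
  hist_prob true h = expR (hist_llr h) * hist_prob false h.
Proof.
elim: h => [|a h IH]; first by rewrite /= expR0 mulr1.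
rewrite hist_llr_cons [LHS]/= IH [in RHS]/=.
by field; rewrite gt_eqF.
Qed.

(** The likelihood ratio of [h] cancels the exponential factor in [action_prob_wrong]. *)
Lemma hist_prob_wrong (b : bool) (h : seq bool) :
  hist_prob b (~~ b :: h) <= hist_prob (~~ b) (~~ b :: h).
Proof.
have := action_prob_wrong b (hist_llr h).
have := hist_prob_llr h; have := hist_prob_gt0 false h.
case: b => /= h0 hE.
  move/(ler_wpM2l (expR_ge0 (hist_llr h))).
  rewrite mulrA -expRD subrr expR0 mul1r => /(ler_wpM2l (ltW h0)).
  by rewrite hE mulrA [_ * expR _]mulrC.
move/(ler_wpM2l (ltW h0)).
by rewrite hE mulrA [_ * expR _]mulrC.
Qed.

(** The sum telescopes: the [n]-th term is the drop in probability when the run of [b] grows from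
    [n] to [n.+1]. It is valid in both states, and is applied in the state [~~ b]. *)
Lemma hist_prob_run (b b' : bool) (h : seq bool) (N : nat) :
  \sum_(n < N) hist_prob b' (~~ b :: (nseq n b ++ h)) <= hist_prob b' h.
Proof.
suff -> : \sum_(n < N) hist_prob b' (~~ b :: (nseq n b ++ h)) =
          hist_prob b' h - hist_prob b' (nseq N b ++ h).
  by rewrite lerBlDl lerDr ltW// hist_prob_gt0.
elim: N => [|N IH]; first by rewrite big_ord0 subrr.
by rewrite big_ord_recr IH -(hist_prob_cons b' b (nseq N b ++ h)) /=; ring.
Qed.

(** * Bhattacharyya sums over histories *)

Definition hist_affinity (h : seq bool) : R :=
  Num.sqrt (hist_prob true h * hist_prob false h).

Lemma hist_affinity_cons (h : seq bool) :
  hist_affinity (true :: h) + hist_affinity (false :: h) = hist_affinity h *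
  bhattacharyya (action_prob true (hist_llr h) false)
                (action_prob false (hist_llr h) false).
Proof.
have E a : hist_affinity (a :: h) = hist_affinity h *
    Num.sqrt (action_prob true (hist_llr h) a * action_prob false (hist_llr h) a).
  by rewrite /hist_affinity /= mulrACA sqrtrM// mulr_ge0// ltW// hist_prob_gt0.
by rewrite !E /bhattacharyya -!action_probT -mulrDr addrC.
Qed.

(** With [l = hist_llr h] and [hist_prob false h] as unit, the affinity is [exp (l / 2)] and the
    minimum is [min (exp l) 1 = exp (l / 2 - |l| / 2)]. *)
Lemma hist_affinity_llr (h : seq bool) :
  Num.min (hist_prob true h) (hist_prob false h) =
  hist_affinity h * expR (- (`|hist_llr h| / 2)).
Proof.
have q0 := hist_prob_gt0 false h.
have -> : hist_affinity h = expR (hist_llr h / 2) * hist_prob false h.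
  rewrite /hist_affinity hist_prob_llr.
  have -> : expR (hist_llr h) = expR (hist_llr h / 2) ^+ 2.
    by rewrite expr2 -expRD -splitr.
  by rewrite -mulrA -expr2 -exprMn sqrtr_sqr ger0_norm// mulr_ge0 ?expR_ge0// ltW.
rewrite hist_prob_llr mulrAC -expRD.
have [l0|l0] := leP 0 (hist_llr h).
  rewrite ger0_norm// subrr expR0 mul1r min_r// ler_pMl//.
  by rewrite -[leLHS]expR0 ler_expR.
rewrite ltr0_norm// mulNr opprK -splitr min_l// ger_pMl//.
by rewrite -[leRHS]expR0 ler_expR ltW.
Qed.

Lemma min_hist_prob_le (K : R) : (forall x, expR (- (`|x| / 2)) <=
    K * (1 - bhattacharyya (action_prob true x false) (action_prob false x false))) ->
  forall h, Num.min (hist_prob true h) (hist_prob false h) <= K *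
    (hist_affinity h - (hist_affinity (true :: h) + hist_affinity (false :: h))).
Proof.
move=> HK h; rewrite hist_affinity_llr hist_affinity_cons -{2}[hist_affinity h]mulr1.
by rewrite -mulrBr mulrCA ler_wpM2l// sqrtr_ge0.
Qed.

Fixpoint histories (t : nat) : seq (seq bool) :=
  if t is t'.+1 then
    [seq true :: h | h <- histories t'] ++ [seq false :: h | h <- histories t']
  else [:: [::]].

Lemma sum_min_hist_prob_le (K : R) : 0 <= K -> (forall x, expR (- (`|x| / 2)) <=
    K * (1 - bhattacharyya (action_prob true x false) (action_prob false x false))) ->
  forall N, \sum_(0 <= t < N) \sum_(h <- histories t)
    Num.min (hist_prob true h) (hist_prob false h) <= K.
Proof.
move=> K0 HK N; pose Z t := \sum_(h <- histories t) hist_affinity h.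
have step t : \sum_(h <- histories t) Num.min (hist_prob true h) (hist_prob false h)
    <= K * (Z t - Z t.+1).
  rewrite /Z /= big_cat /= !big_map -big_split /= -sumrB mulr_sumr.
  by apply: ler_sum => h _; exact: min_hist_prob_le.
apply: le_trans (ler_sum_nat (fun t _ => step t)) _.
rewrite -mulr_sumr -[leRHS]mulr1; apply: ler_wpM2l => //.
under eq_bigr do rewrite -opprB.
rewrite sumrN telescope_sumr// opprB.
have -> : Z 0%N = 1 by rewrite /Z big_seq1 /hist_affinity/= mulr1 sqrtr1.
by rewrite gerBl; apply: sumr_ge0 => h _; exact: sqrtr_ge0.
Qed.

(** * Histories as events of the probability space *)

Context {d : measure_display} {Omega : measurableType d}
  (P : probability Omega R) (theta : Omega -> bool) (s : nat -> Omega -> R).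
Hypotheses (mtheta : measurable [set w | theta w])
  (ms : forall t, measurable_fun setT (s t)).
Hypothesis iid : forall (n : nat) (B : nat -> set R),
  (forall i, measurable (B i)) ->
  fine (P [set w | theta w /\ forall i, (i < n)%N -> B i (s i w)])
    = 2^-1 * \prod_(i < n) fine (Fp (B i)) /\
  fine (P [set w | ~~ theta w /\ forall i, (i < n)%N -> B i (s i w)])
    = 2^-1 * \prod_(i < n) fine (Fm (B i)).

Notation act := (action Fp Fm f s).

Fixpoint history (t : nat) (w : Omega) : seq bool :=
  if t is t'.+1 then act t' w :: history t' w else [::].

Lemma size_history (t : nat) (w : Omega) : size (history t w) = t.
Proof. by elim: t => //= t ->. Qed.

Lemma history_histories (t : nat) (w : Omega) : history t w \in histories t.
Proof.
elim: t => //= t IH; rewrite mem_cat.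
by case: (act t w); apply/orP; [left|right]; exact: map_f.
Qed.

Lemma hist_llr_history (t : nat) (w : Omega) :
  hist_llr (history t w) = pub_llr Fp Fm f s t w.
Proof. by elim: t => //= t ->. Qed.

(** Along a fixed [h] the public log-likelihood ratio is deterministic, so following [h] restricts
    each signal separately. The event is thus a product event, to which [iid] applies. *)
Lemma history_regions (h : seq bool) : exists B : nat -> set R,
  [/\ forall i, measurable (B i),
      forall w, history (size h) w = h <->
                (forall i, (i < size h)%N -> B i (s i w)) &
      forall b, \prod_(i < size h) fine (signal_law b (B i)) = hist_prob b h].
Proof.
elim: h => [|a h [B [mB hB pB]]].
  by exists (fun=> setT); split=> // b; rewrite big_ord0.
(* Every index from [size h] on gets the new region, but only [size h] itself lies below the new
   length. *)
pose B' i := if (i < size h)%N then B i else action_region (hist_llr h) a.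
have B'h : B' (size h) = action_region (hist_llr h) a by rewrite /B' ltnn.
exists B'; split.
- by move=> i; rewrite /B'; case: ifP => _ //; exact: measurable_action_region.
- move=> w; have actE : history (size h) w = h -> act (size h) w = a <->
      action_region (hist_llr h) a (s (size h) w).
    by move=> E; rewrite /action -hist_llr_history E.
  split=> [[aE hE] i|H].
    rewrite /= ltnS leq_eqVlt => /orP[/eqP ->|ih].
      by rewrite B'h; exact/(actE hE).
    by rewrite /B' ih; exact: (hB w).1.
  have hE : history (size h) w = h.
    apply/hB => i ih; have := H i (ltnW ih).
    by rewrite /B' ih.
  rewrite /= hE; congr (_ :: _); apply/(actE hE).
  by rewrite -B'h; exact: H.
- move=> b; rewrite /= big_ord_recr /= B'h; congr (_ * _).
  by rewrite -pB; apply: eq_bigr => i _; rewrite /B' ltn_ord.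
Qed.

Definition history_event (b : bool) (h : seq bool) : set Omega :=
  [set w | theta w = b /\ history (size h) w = h].

Lemma measurable_history_event (b : bool) (h : seq bool) :
  measurable (history_event b h).
Proof.
have [B [mB hB _]] := history_regions h.
have -> : history_event b h = [set w | theta w = b] `&`
    \bigcap_(i in [set i | (i < size h)%N]) (s i @^-1` B i).
  by apply/seteqP; split=> w [tw /hB hw]; split=> //; apply/hB.
apply: measurableI.
  case: b => //; rewrite (_ : mkset _ = ~` [set w | theta w]); first exact: measurableC.
  by apply/seteqP; split=> w /=; [move=> ->|move/negP/negbTE].
apply: bigcap_measurableType => i _.
by rewrite -[X in measurable X]setTI; exact: ms.
Qed.

Lemma history_event_prob (b : bool) (h : seq bool) :
  P (history_event b h) = (2^-1 * hist_prob b h)%:E.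
Proof.
have [B [mB hB pB]] := history_regions h.
rewrite -[LHS]fineK; last first.
  by rewrite fin_num_measure//; exact: measurable_history_event.
congr _%:E; rewrite -pB; have [iT iF] := iid (size h) mB.
case: b => /=; [rewrite -iT|rewrite -iF]; congr (fine (P _));
  apply/seteqP; split=> w /= [tw hw]; split=> //; try exact/hB.
- by rewrite tw.
- exact: negbTE.
Qed.

Lemma history_cat (r h : seq bool) (w : Omega) :
  history (size (r ++ h)) w = r ++ h -> history (size h) w = h.
Proof. by elim: r => //= a r IH [_ /IH]. Qed.

(** * Mistakes made after a given time *)

(** Here [n] counts the correct actions between [h] and the first mistake. *)
Definition wrong_after (b : bool) (h : seq bool) : set Omega :=
  \bigcup_n history_event b (~~ b :: (nseq n b ++ h)).

Lemma measurable_wrong_after (b : bool) (h : seq bool) :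
  measurable (wrong_after b h).
Proof. by apply: bigcup_measurable => n _; exact: measurable_history_event. Qed.

(* The first wrong action makes the history likelier in the other state, so the
   disjoint events of a first wrong action weigh at most the whole history there. *)
Lemma wrong_after_prob (b : bool) (h : seq bool) : (P (wrong_after b h) <=
  (2^-1 * Num.min (hist_prob true h) (hist_prob false h))%:E)%E.
Proof.
have same : (P (wrong_after b h) <= (2^-1 * hist_prob b h)%:E)%E.
  rewrite -history_event_prob; apply: le_measure; rewrite ?inE.
  - exact: measurable_wrong_after.
  - exact: measurable_history_event.
  - by move=> w [n _ [tw hw]]; split=> //; apply: (@history_cat (~~ b :: nseq n b)).
have other : (P (wrong_after b h) <= (2^-1 * hist_prob (~~ b) h)%:E)%E.
  have mE n : measurable (history_event b (~~ b :: (nseq n b ++ h))).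
    exact: measurable_history_event.
  apply: le_trans (measure_sigma_subadditive P mE (measurable_wrong_after b h)
    (fun _ => id)) _.
  apply: lime_le; first by apply: is_cvg_nneseries.
  apply: nearW => N /=; rewrite (eq_bigr (fun n =>
    (2^-1 * hist_prob b (~~ b :: (nseq n b ++ h)))%:E)); last first.
    by move=> n _; exact: history_event_prob.
  rewrite sumEFin lee_fin -mulr_sumr ler_pM2l ?invr_gt0// big_mkord.
  apply: le_trans (hist_prob_run b (~~ b) h N).
  by apply: ler_sum => n _; exact: hist_prob_wrong.
by rewrite /Num.min; case: ifP => _; case: b same other.
Qed.

Definition mistake_after (b : bool) (t : nat) : set Omega :=
  \big[setU/set0]_(h <- histories t) wrong_after b h.

Lemma measurable_mistake_after (b : bool) (t : nat) :
  measurable (mistake_after b t).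
Proof. by apply: bigsetU_measurable => h _; exact: measurable_wrong_after. Qed.

Lemma mistake_after_prob (b : bool) (t : nat) : (P (mistake_after b t) <=
  (2^-1 * \sum_(h <- histories t)
     Num.min (hist_prob true h) (hist_prob false h))%:E)%E.
Proof.
rewrite /mistake_after; elim: (histories t) => [|h hs IH].
  by rewrite !big_nil measure0 mulr0.
rewrite !big_cons mulrDr EFinD.
apply: le_trans (measureU2 P (measurable_wrong_after b h) _) _.
  by apply: bigsetU_measurable => h' _; exact: measurable_wrong_after.
by apply: leeD => //; exact: wrong_after_prob.
Qed.

(** Take the first mistake from time [t] on: the actions before it form a run of [theta w] on top of
    the history at [t]. *)
Lemma mistake_afterP (t tau : nat) (w : Omega) : (t <= tau)%N ->
  act tau w != theta w -> mistake_after (theta w) t w.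
Proof.
move=> t_tau wrong; set b := theta w.
have ex : exists n, act (t + n)%N w != b by exists (tau - t)%N; rewrite subnKC.
case: (ex_minnP ex) => n wn nmin.
have run m : (m <= n)%N -> history (t + m) w = nseq m b ++ history t w.
  elim: m => [|m IH mn]; first by rewrite addn0.
  rewrite addnS /= IH ?(ltnW mn)//; congr (_ :: _); apply/eqP.
  by apply: contraLR mn => /nmin; rewrite -leqNgt.
rewrite /mistake_after -bigcup_seq; exists (history t w).
  exact: history_histories.
exists n => //; split=> //=.
rewrite size_cat size_nseq size_history addnC run//; congr (_ :: _).
by apply/esym/addbP; rewrite addbC -negb_eqb.
Qed.

Definition mistake (t : nat) : set Omega :=
  mistake_after true t `|` mistake_after false t.

Lemma measurable_mistake (t : nat) : measurable (mistake t).
Proof. by apply: measurableU; exact: measurable_mistake_after. Qed.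

Lemma mistake_prob (t : nat) : (P (mistake t) <= (\sum_(h <- histories t)
     Num.min (hist_prob true h) (hist_prob false h))%:E)%E.
Proof.
apply: le_trans (measureU2 P (measurable_mistake_after true t)
  (measurable_mistake_after false t)) _.
apply: le_trans (leeD (mistake_after_prob true t) (mistake_after_prob false t)) _.
by rewrite -EFinD lee_fin; lra.
Qed.

(** * The expected time to learn *)

(* Shifted by one, since [time_to_learn] is at least one. *)
Definition learning_after (n : nat) : set Omega :=
  if n is t.+1 then mistake t else setT.

Lemma measurable_learning_after (n : nat) : measurable (learning_after n).
Proof. by case: n => //= t; exact: measurable_mistake. Qed.

(** If [m] is the least index from which all actions are right, every [t < m] is followed by a
    mistake, so the first [m.+1] indicators equal 1. If there is no such index, all indicators equal
    1 and the series diverges. *)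
Lemma time_to_learn_le (w : Omega) : (time_to_learn Fp Fm f s theta w <=
  \sum_(n <oo) (\1_(learning_after n) w)%:E)%E.
Proof.
have partial N : (forall t, (t < N)%N -> mistake t w) ->
    ((N.+1)%:R%:E <= \sum_(n <oo) (\1_(learning_after n) w)%:E :> \bar R)%E.
  move=> H; apply: le_trans (nneseries_lim_ge N.+1 _); last first.
    by move=> n _ _; rewrite lee_fin.
  rewrite sumEFin lee_fin big_mkord (eq_bigr (fun=> 1)).
    by rewrite sumr_const card_ord.
  move=> [[|i] /= iN] _; rewrite indicE mem_set//; exact: H.
have [good|bad] := pselect (exists t, forall tau, (t <= tau)%N -> act tau w = theta w).
  have {}good : exists t, `[< forall tau, (t <= tau)%N -> act tau w = theta w >].
    by case: good => t gt; exists t; apply/asboolP.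
  case: (ex_minnP good) => m /asboolP gm mmin.
  apply: (@le_trans _ _ (m.+1)%:R%:E); first by apply: ereal_inf_lbound; exists m.
  apply: partial => t tm; apply: contrapT => nt.
  suff /asboolP/mmin : forall tau, (t <= tau)%N -> act tau w = theta w.
    by rewrite leqNgt tm.
  move=> tau t_tau; apply/eqP; apply: contra_notT nt => wrong.
  by have := mistake_afterP t_tau wrong; rewrite /mistake; case: (theta w); [left|right].
suff -> : (\sum_(n <oo) (\1_(learning_after n) w)%:E = +oo :> \bar R)%E by exact: leey.
apply: eq_infty => r.
apply: (@le_trans _ _ ((Num.truncn `|r|).+1)%:R%:E).
  by rewrite lee_fin (le_trans (ler_norm r))// ltW// truncnS_gt.
apply: partial => t _; apply: contrapT => nt; apply: bad; exists t.
move=> tau t_tau; apply/eqP; apply: contra_notT nt => wrong.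
by have := mistake_afterP t_tau wrong; rewrite /mistake; case: (theta w); [left|right].
Qed.

Lemma time_to_learn_ge0 (w : Omega) : (0 <= time_to_learn Fp Fm f s theta w)%E.
Proof. by apply: le_ereal_inf_tmp => _ [t _ <-]; rewrite lee_fin. Qed.

Lemma expected_time_to_learn_le (K : R) : 0 <= K ->
  (forall x, expR (- (`|x| / 2)) <=
    K * (1 - bhattacharyya (action_prob true x false) (action_prob false x false))) ->
  (\int[P]_w time_to_learn Fp Fm f s theta w <= (1 + K)%:E)%E.
Proof.
move=> K0 HK.
have g0 n w : (0 <= (\1_(learning_after n) w)%:E :> \bar R)%E by rewrite lee_fin.
apply: (@le_trans _ _
  (\int[P]_w \sum_(n <oo) (\1_(learning_after n) w)%:E)%E).
  (* The integral of a nonnegative function is a supremum over simple functions below it; comparing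
     these suprema avoids proving [time_to_learn] measurable. *)
  rewrite !ge0_integralTE; last 2 first.
  - by move=> w; exact: nneseries_ge0.
  - exact: time_to_learn_ge0.
  apply: ereal_sup_le => _ [h hle <-]; exists h => // w.
  exact: le_trans (hle w) (time_to_learn_le w).
rewrite integral_nneseries//; last first.
  move=> n; apply/measurable_EFinP; apply: measurable_indic.
  exact: measurable_learning_after.
apply: lime_le.
  by apply: is_cvg_nneseries => n _ _; apply: integral_ge0 => w _; exact: g0.
apply: nearW => N.
rewrite (eq_bigr (fun n => P (learning_after n))); last first.
  by move=> n _; rewrite integral_indic ?setIT//; exact: measurable_learning_after.
case: N => [|N]; first by rewrite big_geq// lee_fin; lra.
(* The term [n = 0] is the whole space and gives the 1; the others are the events [mistake t]. *)
rewrite big_nat_recl//= probability_setT EFinD leeD2l//.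
apply: (@le_trans _ _ (\sum_(0 <= t < N) (\sum_(h <- histories t)
     Num.min (hist_prob true h) (hist_prob false h))%:E)%E).
  by apply: lee_sum => t _; exact: mistake_prob.
by rewrite sumEFin lee_fin; exact: sum_min_hist_prob_le.
Qed.

End Signals.

(** * Positivity of the action probabilities and conclusion *)

Theorem theorem6 (R : realType) (d : measure_display) (Omega : measurableType d)
  (P : probability Omega R) (theta : Omega -> bool) (s : nat -> Omega -> R)
  (Fp Fm : probability R R) (f : R -> R) :
  (* conditional signal distributions are mutually absolutely continuous,
     f is a positive version of dF_+/dF_- *)
  Fp `<< Fm -> Fm `<< Fp ->
  measurable_fun setT f -> (forall u, 0 < f u) ->
  (forall B, measurable B -> Fp B = (\int[Fm]_(u in B) (f u)%:E)%E) ->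
  (* the state and the signals *)
  measurable [set w | theta w] ->
  (forall t, measurable_fun setT (s t)) ->
  fine (P [set w | theta w]) = 2^-1 ->
  (* conditionally on theta, the signals are i.i.d. with law F_+ / F_- *)
  (forall (n : nat) (B : nat -> set R), (forall i, measurable (B i)) ->
     fine (P [set w | theta w /\ forall i, (i < n)%N -> B i (s i w)])
       = 2^-1 * \prod_(i < n) fine (Fp (B i)) /\
     fine (P [set w | ~~ theta w /\ forall i, (i < n)%N -> B i (s i w)])
       = 2^-1 * \prod_(i < n) fine (Fm (B i))) ->
  (* unbounded signals *)
  (forall (t : nat) (M : R),
     (0 < P [set w | (M < LLR f (s t w))%R])%E /\
     (0 < P [set w | (LLR f (s t w) < - M)%R])%E) ->
  (* polynomial tails *)
  (exists c k x0 : R, 0 < c /\ 0 < k /\ 0 < x0 /\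
     forall x, x0 < x ->
       Gm Fm f (- x) = c * powR x (- k) /\ Gp Fp f x = 1 - c * powR x (- k)) ->
  (\int[P]_w time_to_learn Fp Fm f s theta w < +oo)%E.
Proof.
move=> FpFm FmFp mf f0 dens mth ms _ iid unb [c [k [x0 [c0 [k0 [x00 tails]]]]]].
(* If one law gave [A] mass 0, both would, by mutual absolute continuity; then [iid] with [n = 1]
   makes the first signal avoid [A] almost surely in either state. *)
have charged (A : set R) : measurable A -> (0 < P (s 0%N @^-1` A))%E ->
    forall b, 0 < fine (signal_law Fp Fm b A).
  move=> mA P0 b; rewrite lt_neqAle fine_ge0// andbT; apply/negP => /eqP A0.
  have bA0 : signal_law Fp Fm b A = 0%E.
    by rewrite -[LHS]fineK ?fin_num_measure// -A0.
  have [FpA FmA] : Fp A = 0%E /\ Fm A = 0%E.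
    case: b bA0 {A0} => /= F0; split=> //.
      by move/null_content_dominatesP: FmFp; apply.
    by move/null_content_dominatesP: FpFm; apply.
  have [] := iid 1%N (fun=> A) (fun=> mA).
  rewrite !big_ord1 FpA FmA /= mulr0 => PT PF.
  have mTA : measurable [set w | theta w /\ forall i, (i < 1)%N -> A (s i w)].
    rewrite (_ : mkset _ = [set w | theta w] `&` (s 0%N @^-1` A)).
      by apply: measurableI => //; rewrite -[X in measurable X]setTI; exact: ms.
    by apply/seteqP; split=> w /= [tw] => [/(_ 0%N isT)|Aw] //; split=> // [[]].
  have mFA : measurable [set w | ~~ theta w /\ forall i, (i < 1)%N -> A (s i w)].
    rewrite (_ : mkset _ = ~` [set w | theta w] `&` (s 0%N @^-1` A)).
      apply: measurableI; first exact: measurableC.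
      by rewrite -[X in measurable X]setTI; exact: ms.
    by apply/seteqP; split=> w /= [tw] => [/(_ 0%N isT)|Aw];
      split=> //; [exact/negP|exact/negP|case].
  have mA0 : measurable (s 0%N @^-1` A).
    by rewrite -[X in measurable X]setTI; exact: ms.
  have sub : s 0%N @^-1` A `<=`
      [set w | theta w /\ forall i, (i < 1)%N -> A (s i w)] `|`
      [set w | ~~ theta w /\ forall i, (i < 1)%N -> A (s i w)].
    by move=> w Aw; have [tw|tw] := boolP (theta w); [left|right]; split=> // [[]].
  have : (P (s 0%N @^-1` A) <=
      P [set w | theta w /\ forall i, (i < 1)%N -> A (s i w)] +
      P [set w | ~~ theta w /\ forall i, (i < 1)%N -> A (s i w)])%E.
    exact: le_trans (le_measure P (mem_set mA0) (mem_set (measurableU _ _ mTA mFA)) sub)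
      (measureU2 P mTA mFA).
  have null E : measurable E -> fine (P E) = 0 -> P E = 0%E.
    by move=> mE E0; rewrite -[LHS]fineK ?fin_num_measure// E0.
  by rewrite (null _ mTA PT) (null _ mFA PF) adde0 leNgt P0.
have supp b l a : 0 < action_prob Fp Fm f b l a.
  rewrite /action_prob; apply: charged; first exact: measurable_action_region.
  case: a.
    by rewrite action_regionT; have [] := unb 0%N (- l).
  (* Unboundedness concerns the strict inequality [LLR < - l], while the region of [false] includes
     ties; monotonicity of [P] bridges the two. *)
  rewrite action_regionF; have [_] := unb 0%N l.
  move/lt_le_trans; apply; apply: le_measure; rewrite ?inE.
  - rewrite -[X in measurable X]setTI; apply: (ms 0%N measurableT [set u | LLR f u < - l]).
    rewrite (_ : mkset _ = ~` [set u | - l <= LLR f u]).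
      apply: measurableC; rewrite -[X in measurable X]setTI.
      by apply: measurable_fun_le => //; exact: measurable_LLR.
    by apply/seteqP; split=> u /=; rewrite ltNge => /negP.
  - rewrite -[X in measurable X]setTI; apply: ms => //.
    exact: measurable_LLR_le.
  - by move=> w /= /ltW.
have [K K0 HK] := bhattacharyya_polynomial_tails mf f0 dens c0 k0 x00 tails.
apply: le_lt_trans (ltry (1 + K)).
by apply: (expected_time_to_learn_le mf f0 dens supp mth ms iid) => //; exact: ltW.
Qed.
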